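(* Consider the mixed-integer linear program (MILP) $$\min_{z}\ c^\top z\quad\text{subject to}\quad a_i^\top z\le b_i,\ i=1,\dots,n,\quad z\in\mathbb{Z}^{d_Z}\times\mathbb{R}^{d_R},$$ with $d=d_Z+d_R$, $a_i,c\in\mathbb{R}^d$, $b_i\in\mathbb{R}$. Let $P=\bigcap_{i=1}^n\{z\in\mathbb{R}^d: a_i^\top z\le b_i\}$ and $P_I=P\cap(\mathbb{Z}^{d_Z}\times\mathbb{R}^{d_R})$. Assume that $P$ is bounded, that $\mathrm{conv}(P_I)$ is nonempty, that $P\subseteq H_M$ where $H_M=\{z\in\mathbb{R}^d:-M\le z_\ell\le M,\ \ell=1,\dots,d\}$ with $M>0$, and that the optimal cost of the MILP is an integer. Suppose that $N=n$ agents communicate according to a jointly strongly connected time-varying digraph $\mathcal{G}_c(t)$, $t\ge 0$, and run the INT-DiCUT-MILP distributed algorithm (defined in the context), producing $z^{[i]}(t)$ for $i\in\{1,\dots,N\}$, $t\ge0$. Let $J^{[i]}(t)=c^\top z^{[i]}(t)$. Then, in a finite number of communication rounds, for every $i\in\{1,\dots,N\}$ the sequences $\{J^{[i]}(t)\}_{t\ge0}$ and $\{z^{[i]}(t)\}_{t\ge0}$ converge, respectively, to the (integer-valued) optimal cost and to the lex-optimal solution of the MILP; that is, there is a finite $T$ such that for all $t\ge T$ and all $i$, $J^{[i]}(t)$ equals the optimal cost and $z^{[i]}(t)$ equals the lex-optimal solution.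
   Context: Lexicographic order and lex-optimality. For $v,w\in\mathbb{R}^d$, $v>_{lex}w$ if there is $\ell$ with $v_\ell>w_\ell$ and $v_m=w_m$ for all $m<\ell$. The lex-optimal solution of an optimization problem is its lexicographically minimal optimal solution. For a linear program (LP) whose constraint set is a finite intersection of half-spaces of $\mathbb{R}^d$, a basis (for the lex-optimal solution $z^{LP}$) is the intersection of a minimal number of these half-spaces such that the lex-optimal solution of the LP over the intersection is still $z^{LP}$; it consists of exactly $d$ half-spaces, and is written $B=\{z:A_Bz\le b_B\}$ with $A_B\in\mathbb{R}^{d\times d}$ invertible. $\mathrm{LPlexsolv}(H,c)$ returns the lex-optimal solution of $\min\{c^\top z: z\in H\}$ together with a basis identifying it. MIG cut. Integer-constrained variables are the first $d_Z$ components. Let $(z^{LP},B^{LP})$ be a lex-optimal solution and basis with $z^{LP}_\ell\notin\mathbb{Z}$, $\ell\le d_Z$. Let $r^m$ be the $m$-th column of $-A_B^{-1}$, $m=1,\dots,d$, and let $e_\ell$ be the $\ell$-th canonical vector. Put $\lambda_m=\frac{\lfloor z^{LP}_\ell\rfloor-z^{LP}_\ell}{e_\ell^\top r^m}$ if $e_\ell^\top r^m<0$, $\lambda_m=\frac{\lfloor z^{LP}_\ell\rfloor+1-z^{LP}_\ell}{e_\ell^\top r^m}$ if $e_\ell^\top r^m>0$, $\lambda_m=\infty$ if $e_\ell^\top r^m=0$; and $\Lambda_m=1/\lambda_m$ ($\Lambda_m=0$ if $\lambda_m=\infty$). The intersection cut to the disjunction $\{z_\ell\le\lfloor z^{LP}_\ell\rfloor\}\cup\{z_\ell\ge\lfloor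 z^{LP}_\ell\rfloor+1\}$ and basis $B^{LP}$ is $\{z:\Lambda^\top A_Bz\le\Lambda^\top b_B-1\}$. $\mathrm{MIGoracle}(z,B)$ returns this cut for $\ell=\min\{k\le d_Z:z_k\notin\mathbb{Z}\}$; if $z_1,\dots,z_{d_Z}$ are all integers it returns no constraint (i.e. $\mathbb{R}^d$). Network. Agents are $V=\{1,\dots,N\}$; at time $t\in\mathbb{N}$ the communication digraph is $\mathcal{G}_c(t)=(V,E(t))$, with $(i,j)\in E(t)$ iff $i$ can send information to $j$ at time $t$; $\mathcal{N}_i(t)=\{j:(j,i)\in E(t)\}$. The time-varying digraph is jointly strongly connected if for every $t\in\mathbb{N}$ the digraph $\bigcup_{\tau=t}^\infty\mathcal{G}_c(\tau)$ is strongly connected. INT-DiCUT-MILP. Agent $i$ knows $h^{[i]}=\{a_i^\top z\le b_i\}\cap H_M$. Initialization: $(z^{[i]}(0),B^{[i]}(0))=\mathrm{LPlexsolv}(h^{[i]},c)$. At each $t\ge0$ every agent $i$ sets $h_{mig}(t)=\mathrm{MIGoracle}(z^{[i]}(t),B^{[i]}(t))$, $h_c(t)=\{z:c^\top z\ge\lceil c^\top z^{[i]}(t)\rceil\}$, $$H_{tmp}(t)=\Big(\bigcap_{j\in\mathcal{N}_i(t)}B^{[j]}(t)\Big)\cap B^{[i]}(t)\cap h^{[i]}\cap h_{mig}(t)\cap h_c(t),$$ and $(z^{[i]}(t+1),B^{[i]}(t+1))=\mathrm{LPlexsolv}(H_{tmp}(t),c)$. *)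

(* Defs.v *)
From HB Require Import structures.
From mathcomp Require Import all_boot all_order all_algebra.
From mathcomp Require Import all_classical all_reals all_analysis.
Set Implicit Arguments.
Unset Strict Implicit.
Unset Printing Implicit Defensive.
Import Order.TTheory GRing.Theory Num.Theory.
Import numFieldNormedType.Exports.
Local Open Scope classical_set_scope.
Local Open Scope ring_scope.

Definition dotv (R : realType) (d : nat) (u v : 'cV[R]_d) : R :=
  (u^T *m v) 0 0.

Definition lex_gt (R : realType) (d : nat) (v w : 'cV[R]_d) : Prop :=
  exists l : 'I_d, w l 0 < v l 0 /\
    forall m : 'I_d, (m < l)%N -> v m 0 = w m 0.

Definition is_optimal (R : realType) (d : nat) (F : set 'cV[R]_d)
    (c z : 'cV[R]_d) : Prop :=
  F z /\ forall y, F y -> dotv c z <= dotv c y.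

Definition is_lexopt (R : realType) (d : nat) (F : set 'cV[R]_d)
    (c z : 'cV[R]_d) : Prop :=
  is_optimal F c z /\
  forall y, is_optimal F c y -> y = z \/ lex_gt y z.

Definition conv_hull (R : realType) (d : nat) (A : set 'cV[R]_d) :
    set 'cV[R]_d :=
  \bigcap_(C in [set C : set 'cV[R]_d | convex_set C /\ A `<=` C]) C.

(* The pair (a, b) stands for {z | a^T z <= b}.  The normal a may be 0, as
   happens for the cost cut when c = 0. *)
Definition halfspace (R : realType) (d : nat) : Type := ('cV[R]_d * R)%type.

Definition polyhedron (R : realType) (d : nat) (H : seq (halfspace R d)) :
    set 'cV[R]_d :=
  [set z | forall h, h \in H -> dotv h.1 z <= h.2].

Definition basis_mx (R : realType) (d : nat) (B : d.-tuple (halfspace R d)) :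
    'M[R]_d :=
  \matrix_(m < d, k < d) (tnth B m).1 k 0.

Definition basis_rhs (R : realType) (d : nat)
    (B : d.-tuple (halfspace R d)) : 'cV[R]_d :=
  \col_(m < d) (tnth B m).2.

Definition is_basis (R : realType) (d : nat) (H : seq (halfspace R d))
    (c z : 'cV[R]_d) (B : d.-tuple (halfspace R d)) : Prop :=
  [/\ {subset B <= H},
      is_lexopt (polyhedron B) c z,
      forall B' : seq (halfspace R d), {subset B' <= H} ->
        is_lexopt (polyhedron B') c z -> (d <= size B')%N
    & basis_mx B \in unitmx].

(* Bases need not be unique, so LPlexsolv is given by its input-output
   specification: (z, B) is an admissible answer on (H, c).  The answer is
   unconstrained when the LP has no lex-optimal solution. *)
Definition LPlexsolv (R : realType) (d : nat) (H : seq (halfspace R d))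
    (c z : 'cV[R]_d) (B : d.-tuple (halfspace R d)) : Prop :=
  (exists z', is_lexopt (polyhedron H) c z') ->
  is_lexopt (polyhedron H) c z /\ is_basis H c z B.

Section MIG.
Variables (R : realType) (dZ dR : nat).
Local Notation d := (dZ + dR)%N.

Definition first_fractional (z : 'cV[R]_d) : option 'I_dZ :=
  [pick k : 'I_dZ | (z (lshift dR k) 0 \isn't a Num.int) &&
     [forall j : 'I_dZ, (j < k)%N ==> (z (lshift dR j) 0 \is a Num.int)]].

Definition mig_lambda (z : 'cV[R]_d) (B : d.-tuple (halfspace R d))
    (l m : 'I_d) : \bar R :=
  let r := col m (- invmx (basis_mx B)) in
  let f := (Num.floor (z l 0))%:~R in
  if r l 0 < 0 then ((f - z l 0) / r l 0)%:E
  else if 0 < r l 0 then ((f + 1 - z l 0) / r l 0)%:E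
  else +oo%E.

Definition mig_Lambda (z : 'cV[R]_d) (B : d.-tuple (halfspace R d))
    (l : 'I_d) : 'cV[R]_d :=
  \col_(m < d) (if mig_lambda z B l m is x%:E then 1 / x else 0).

Definition mig_cut (z : 'cV[R]_d) (B : d.-tuple (halfspace R d))
    (l : 'I_d) : halfspace R d :=
  let L := mig_Lambda z B l in
  ((L^T *m basis_mx B)^T, dotv L (basis_rhs B) - 1).

Definition MIGoracle (z : 'cV[R]_d) (B : d.-tuple (halfspace R d)) :
    seq (halfspace R d) :=
  if first_fractional z is Some k then [:: mig_cut z B (lshift dR k)]
  else [::].

End MIG.

Definition cost_cut (R : realType) (d : nat) (c z : 'cV[R]_d) :
    halfspace R d :=
  (- c, - (Num.ceil (dotv c z))%:~R).

Definition box (R : realType) (d : nat) (M : R) : seq (halfspace R d) :=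
  [seq (delta_mx l 0, M) | l <- enum 'I_d] ++
  [seq (- delta_mx l 0, M) | l <- enum 'I_d].

Definition union_digraph (n : nat) (E : nat -> rel 'I_n) (t : nat) :
    rel 'I_n :=
  fun i j => `[< exists2 tau, (t <= tau)%N & E tau i j >].

Definition jointly_strongly_connected (n : nat) (E : nat -> rel 'I_n) : Prop :=
  forall t (i j : 'I_n), connect (union_digraph E t) i j.

Section MILP.
Variables (R : realType) (dZ dR n : nat).
Local Notation d := (dZ + dR)%N.
Variables (c : 'cV[R]_d) (a : 'I_n -> 'cV[R]_d) (b : 'I_n -> R).

Definition milp_P : set 'cV[R]_d := [set z | forall i, dotv (a i) z <= b i].

Definition milp_PI : set 'cV[R]_d :=
  milp_P `&` [set z | forall k : 'I_dZ, z (lshift dR k) 0 \is a Num.int].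

Definition milp_cost : R := inf [set dotv c z | z in milp_PI].

Variables (M : R) (E : nat -> rel 'I_n).

Definition local_constraints (i : 'I_n) : seq (halfspace R d) :=
  (a i, b i) :: box d M.

Definition tmp_constraints (z : 'I_n -> 'cV[R]_d)
    (B : 'I_n -> d.-tuple (halfspace R d)) (t : nat) (i : 'I_n) :
    seq (halfspace R d) :=
  flatten [seq tval (B j) | j <- enum 'I_n & E t j i] ++
  B i ++ local_constraints i ++ MIGoracle (z i) (B i) ++
  [:: cost_cut c (z i)].

Definition int_dicut_run (z : nat -> 'I_n -> 'cV[R]_d)
    (B : nat -> 'I_n -> d.-tuple (halfspace R d)) : Prop :=
  (forall i, LPlexsolv (local_constraints i) c (z 0 i) (B 0 i)) /\
  (forall t i, LPlexsolv (tmp_constraints (z t) (B t) t i) c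
                 (z t.+1 i) (B t.+1 i)).

End MILP.

(* Main.v *)
Require Import Defs.
From mathcomp Require Import all_boot all_order all_algebra.
From mathcomp Require Import all_classical all_reals all_analysis.
From mathcomp Require Import zify.
Import Order.TTheory GRing.Theory Num.Theory.
Import numFieldNormedType.Exports.
Local Open Scope classical_set_scope.
Local Open Scope ring_scope.

Set Implicit Arguments.
Unset Strict Implicit.
Unset Printing Implicit Defensive.

(** Order points by the lexicographic order of the keys
    (c^T z, z_1, ..., z_d).  The lex-optimal solution of a basis is the apex of
    a cone whose rays are lexicographically positive, so the estimate of each
    agent increases at every round and stays below the lex-optimal solution of
    the MILP, which satisfies every constraint ever generated.  As long as the
    earlier keys are constant, the cost cut (first key) or the MIG cut (an
    integer variable) pushes the next key up to its ceiling; hence the cost and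
    the integer variables become constant and integral one after the other.
    From then on no new half-space appears, only finitely many bases remain and
    every estimate becomes constant.  An agent then dominates its in-neighbours,
    so by connectivity all the estimates agree; their common value satisfies
    every a_i^T z <= b_i, hence is feasible and equals the lex-optimal
    solution. *)

(** * The lexicographic order of the keys *)

Section LexOrder.
Variables (R : realType) (d : nat).
Implicit Types (c x y z u v w : 'cV[R]_d) (k : nat) (t : R).
Implicit Types F G : set 'cV[R]_d.

Lemma dotvE u v : dotv u v = \sum_i u i 0 * v i 0.
Proof. by rewrite /dotv mxE; apply: eq_bigr => i _; rewrite mxE. Qed.

Lemma dotvDr u v w : dotv u (v + w) = dotv u v + dotv u w.
Proof. by rewrite /dotv mulmxDr mxE. Qed.

Lemma dotvZr t u v : dotv u (t *: v) = t * dotv u v.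
Proof. by rewrite /dotv -scalemxAr mxE. Qed.

Lemma dotv0r u : dotv u 0 = 0.
Proof. by rewrite /dotv mulmx0 mxE. Qed.

Lemma dotvNl u v : dotv (- u) v = - dotv u v.
Proof. by rewrite /dotv linearN mulNmx mxE. Qed.

Lemma dotvBr u v w : dotv u (v - w) = dotv u v - dotv u w.
Proof. by rewrite dotvDr -scaleN1r dotvZr mulN1r. Qed.

Lemma dotv_sumr (I : Type) (r : seq I) (f : I -> 'cV[R]_d) u :
  dotv u (\sum_(i <- r) f i) = \sum_(i <- r) dotv u (f i).
Proof. by rewrite /dotv mulmx_sumr summxE. Qed.

Lemma dotv_deltal (l : 'I_d) v : dotv (delta_mx l 0) v = v l 0.
Proof.
rewrite dotvE (bigD1 l) //= big1 ?addr0 ?mxE ?eqxx ?mul1r // => i il.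
by rewrite mxE (negPf il) mul0r.
Qed.

Lemma dotv_continuous u : continuous (dotv u).
Proof.
have -> : dotv u = fun v => \sum_i u i 0 * v i 0.
  by apply/funext => v; exact: dotvE.
apply: continuous_big => [|i _ v]; first exact: add_continuous.
have vi : (w i 0 : R) @[w --> v] --> v i 0 by exact: coord_continuous.
exact: (@cvgMl_tmp _ _ (nbhs v) _ (fun w : 'cV[R]_d => w i 0) _ _ vi).
Qed.

(* Lexicographic minimality among optimal solutions is minimality for the
   lexicographic order of (c^T z, z_1, ..., z_d); the entry of index k of this
   tuple is [dotv (lexrow c k) z], and it is 0 for k > d. *)
Definition lexrow c k : 'cV[R]_d :=
  if k is k'.+1 then (if insub k' is Some l then delta_mx l 0 else 0) else c.

Definition lexkey c k z : R := dotv (lexrow c k) z.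

Definition lexlt c x y : Prop :=
  exists k, lexkey c k x < lexkey c k y /\
    forall m, (m < k)%N -> lexkey c m x = lexkey c m y.

Definition lexle c x y : Prop := x = y \/ lexlt c x y.

Lemma lexkey0 c z : lexkey c 0 z = dotv c z. Proof. by []. Qed.

Lemma lexkeyS c (l : 'I_d) z : lexkey c l.+1 z = z l 0.
Proof. by rewrite /lexkey /= valK dotv_deltal. Qed.

Lemma lexkey_default c k z : (d < k)%N -> lexkey c k z = 0.
Proof.
case: k => // k; rewrite ltnS leqNgt => dk.
by rewrite /lexkey /= insubN ?dk // /dotv trmx0 mul0mx mxE.
Qed.

Lemma lexkeyD c k x y : lexkey c k (x + y) = lexkey c k x + lexkey c k y.
Proof. exact: dotvDr. Qed.

Lemma lexkey_inj c x y :
  (forall k, (k <= d)%N -> lexkey c k x = lexkey c k y) -> x = y.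
Proof.
move=> H; apply/colP => l; rewrite -!(lexkeyS c); apply: H; exact: ltn_ord.
Qed.

Lemma lexlt_irr c x : ~ lexlt c x x.
Proof. by case=> k []; rewrite ltxx. Qed.

Lemma lexlt_trans c x y z : lexlt c x y -> lexlt c y z -> lexlt c x z.
Proof.
move=> [k [xyk eqxy]] [j [yzj eqyz]].
have [jk|kj|kj] := ltngtP j k.
- exists j; split; first by rewrite eqxy.
  by move=> m mj; rewrite eqxy ?eqyz // (ltn_trans mj).
- exists k; split; first by rewrite -eqyz.
  by move=> m mk; rewrite eqxy ?eqyz // (ltn_trans mk).
- move: kj yzj eqyz => ->; exists k; split; first exact: lt_trans yzj.
  by move=> m mk; rewrite eqxy ?eqyz.
Qed.

Lemma lexle_refl c x : lexle c x x. Proof. by left. Qed.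

Lemma lexle_trans c x y z : lexle c x y -> lexle c y z -> lexle c x z.
Proof.
move=> [-> //|xy] [<-|yz]; right => //; exact: lexlt_trans yz.
Qed.

Lemma lexle_anti c x y : lexle c x y -> lexle c y x -> x = y.
Proof.
by move=> [-> //|xy] [-> //|yx]; case: (@lexlt_irr c x); apply: lexlt_trans yx.
Qed.

Lemma lexle_addr c x y w : lexle c x y -> lexle c (x + w) (y + w).
Proof.
move=> [->|[k [xyk eqxy]]]; first by left.
right; exists k; rewrite !lexkeyD ltrD2r; split => // m mk.
by rewrite !lexkeyD eqxy.
Qed.

Lemma lexle_key c x y k : lexle c x y ->
  (forall m, (m < k)%N -> lexkey c m x = lexkey c m y) ->
  lexkey c k x <= lexkey c k y.
Proof.
move=> [-> //|[j [xyj eqxy]]] H; have [jk|kj|kj] := ltngtP j k.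
- by move: xyj; rewrite H // ltxx.
- by rewrite eqxy.
- by rewrite -kj ltW.
Qed.

Lemma is_lexoptP F c z :
  is_lexopt F c z <-> F z /\ forall y, F y -> lexle c z y.
Proof.
split=> [[[Fz zmin] zlex]|[Fz zmin]].
  split=> // y Fy; have := zmin _ Fy; rewrite le_eqVlt => /orP[/eqP czy|czy].
    have [|->|[l [zyl eqzy]]] := zlex y.
    - by split=> // w Fw; rewrite -czy zmin.
    - by left.
    - right; exists l.+1; rewrite !lexkeyS; split => // -[|m] //.
      rewrite ltnS => ml; have md : (m < d)%N := ltn_trans ml (ltn_ord l).
      by rewrite -[m]/(val (Ordinal md)) !lexkeyS eqzy.
  by right; exists 0; split.
have le0 y : F y -> dotv c z <= dotv c y.
  by move=> /zmin zy; apply: (lexle_key (k := 0) zy).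
split=> // y [Fy ymin]; have cyz : dotv c y = dotv c z.
  by apply/eqP; rewrite eq_le ymin // le0.
(* The deciding key is an entry: the costs tie, and keys of index beyond [d] are all 0. *)
have [->|[k [zyk eqzy]]] := zmin _ Fy; first by left.
right; case: k zyk eqzy => [|k] zyk eqzy.
  by move: zyk; rewrite !lexkey0 cyz ltxx.
have [kd|dk] := ltnP k d; last by move: zyk; rewrite !lexkey_default ?ltxx.
exists (Ordinal kd); split=> [|m mk]; first by rewrite -!(lexkeyS c).
by rewrite -!(lexkeyS c) eqzy.
Qed.

(** * Existence of lex-optimal solutions on compact sets *)

Lemma compact_lexopt F c :
  compact F -> F !=set0 -> exists z, is_lexopt F c z.
Proof.
move=> cF F0.
(* The keys are minimised one after the other: a point of [G] either strictly precedes [y], or ties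
   with it on the first [k] keys, in which case [y] is in [G] as well. *)
have lexmin k : exists G, [/\ compact G, G !=set0, G `<=` F &
    forall x y, G x -> F y -> lexlt c x y \/
      (G y /\ forall m, (m < k)%N -> lexkey c m x = lexkey c m y)].
  elim: k => [|k [G [cG G0 GF Gmin]]].
    by exists F; split=> // x y _ Fy; right.
  have [|x0 /set_mem Gx0 x0min] := compact_EVT_min G0 cG (f := lexkey c k).
    by apply: continuous_subspaceT; exact: dotv_continuous.
  have mini y : G y -> lexkey c k x0 <= lexkey c k y.
    by move=> Gy; apply: x0min; apply/mem_set.
  exists (G `&` [set y | lexkey c k y <= lexkey c k x0]); split.
  - apply: compact_closedI => //.
    apply: (@preimage_closed _ _ (lexkey c k) [set r | r <= lexkey c k x0]).
      by move=> v _; exact: dotv_continuous.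
    exact: closed_le.
  - by exists x0; split => /=.
  - by move=> y [/GF].
  move=> x y [Gx xk] Fy; have [|[Gy eqxy]] := Gmin _ _ Gx Fy; first by left.
  have xE : lexkey c k x = lexkey c k x0 by apply/le_anti; rewrite xk mini.
  have := mini _ Gy; rewrite le_eqVlt => /orP[/eqP yk|yk].
    right; split; first by split => //=; rewrite yk.
    move=> m; rewrite ltnS leq_eqVlt => /orP[/eqP->|/eqxy//].
    by rewrite xE.
  by left; exists k; rewrite xE.
(* The cost and the [d] entries make [d.+1] keys, and these determine the point. *)
have [G [_ [z Gz] GF Gmin]] := lexmin d.+1.
exists z; apply/is_lexoptP; split=> [|y Fy]; first exact: GF.
have [|[_ eqzy]] := Gmin _ _ Gz Fy; first by right.
by left; apply: (@lexkey_inj c) => k kd; apply: eqzy.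
Qed.

Lemma polyhedron_closed (H : seq (halfspace R d)) : closed (polyhedron H).
Proof.
have -> : polyhedron H =
    \bigcap_(h in [set` H]) (dotv h.1 @^-1` [set r | r <= h.2]).
  by apply/seteqP; split => z Hz h hH; apply: Hz.
apply: closed_bigI => h _; apply: preimage_closed; last exact: closed_le.
by move=> v _; exact: dotv_continuous.
Qed.

Lemma trmx_continuous (m n : nat) (T : topologicalType) :
  continuous (@trmx T m n).
Proof.
move=> A S [P AP PS]; exists (fun i j => P j i).
  by move=> i j; have := AP j i; rewrite mxE.
by move=> N NP; apply: PS => i j; rewrite mxE; exact: NP.
Qed.

Lemma box_bounds (M : R) z :
  polyhedron (box d M) z -> forall l, - M <= z l 0 <= M.
Proof.
move=> zb l; rewrite -dotv_deltal lerNl -dotvNl.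
apply/andP; split.
- apply: (zb (- delta_mx l 0, M)); rewrite mem_cat; apply/orP; right.
  by apply: (map_f (fun l => (- delta_mx l 0, M))); rewrite mem_enum.
- apply: (zb (delta_mx l 0, M)); rewrite mem_cat; apply/orP; left.
  by apply: (map_f (fun l => (delta_mx l 0, M))); rewrite mem_enum.
Qed.

(** Transposition carries a product of segments, compact among row vectors, onto a compact set
    containing [F]. *)
Lemma closed_box_compact (M : R) F :
  closed F -> F `<=` polyhedron (box d M) -> compact F.
Proof.
move=> clF Fbox.
pose K := [set v : 'rV[R]_d | forall l, `[- M, M]%classic (v ord0 l)].
have cK : compact K.
  apply: (@rV_compact _ _ (fun=> `[- M, M]%classic)) => l.
  exact: segment_compact.
apply: (@subclosed_compact _ F (trmx @` K)) => //.
  apply: continuous_compact => //.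
  by apply: continuous_subspaceT; exact: trmx_continuous.
move=> z /Fbox zb; exists z^T; last by rewrite trmxK.
by move=> l /=; rewrite in_itv /= mxE box_bounds.
Qed.

End LexOrder.

(** A non-integer lies in the open interval from its floor to its floor plus 1, which contains no
    integer. *)
Lemma closed_Rint (R : realType) : closed [set x : R | x \is a Num.int].
Proof.
rewrite -[X in closed X]setCK; apply: open_closedC.
rewrite openE => x /= /negP xN; rewrite /interior.
have fx : (Num.floor x)%:~R < x.
  by rewrite lt_neqAle -intrEfloor (negPf xN) /= floor_le.
have xf : x < (Num.floor x + 1)%:~R by exact: floorD1_gt.
have xin : x \in `](Num.floor x)%:~R, (Num.floor x + 1)%:~R[.
  by rewrite in_itv /= fx xf.
apply: filterS (near_in_itvoo xin) => y.
rewrite /= in_itv /= => /andP[fy yf] /intrP[m ym].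
by move: fy yf; rewrite ym !ltr_int ltzD1 ltNge => /negPf->.
Qed.

(** * Bases and MIG cuts *)

Section Basis.
Variables (R : realType) (d : nat) (c z : 'cV[R]_d).
Variable B : d.-tuple (halfspace R d).

Definition ray (m : 'I_d) : 'cV[R]_d := col m (- invmx (basis_mx B)).

(** Once [z] is known to be the apex of the basis, these are the coordinates of [y - z] along the
    rays. *)
Definition slack (y : 'cV[R]_d) : 'cV[R]_d := basis_rhs B - basis_mx B *m y.

Lemma basis_polyhedronP y :
  polyhedron B y <-> forall m, 0 <= slack y m 0.
Proof.
have sE m : slack y m 0 = (tnth B m).2 - dotv (tnth B m).1 y.
  rewrite !mxE dotvE; congr (_ - _).
  by apply: eq_bigr => k _; rewrite mxE.
split=> [Py m|sy h /tnthP[m ->]].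
  by rewrite sE subr_ge0; apply: Py; exact: mem_tnth.
by rewrite -subr_ge0 -sE.
Qed.

Lemma slackD y w : slack (y + w) = slack y - basis_mx B *m w.
Proof. by rewrite /slack mulmxDr opprD addrA. Qed.

Hypotheses (zopt : is_lexopt (polyhedron B) c z) (Bu : basis_mx B \in unitmx).

Let zmin y : (forall m, 0 <= slack y m 0) -> lexle c z y.
Proof.
move=> /basis_polyhedronP Py; have [_ H] := (is_lexoptP _ _ _).1 zopt.
exact: H.
Qed.

Let zfeas m : 0 <= slack z m 0.
Proof.
by move: m; apply/basis_polyhedronP; have [] := (is_lexoptP _ _ _).1 zopt.
Qed.

Lemma basis_mul_ray m : basis_mx B *m ray m = - delta_mx m 0.
Proof. by rewrite /ray colE mulNmx mulmxN mulKVmx. Qed.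

(* If constraint m were slack at z, moving z along the m-th ray, in either
   direction, would preserve feasibility. *)
Lemma basis_slack0 : slack z = 0.
Proof.
apply/colP => m; rewrite [RHS]mxE.
(* The step length is the whole slack, so that [z - w] makes constraint [m] exactly tight. *)
set s := slack z m 0; set w := s *: ray m.
have Aw : basis_mx B *m w = - s *: delta_mx m 0.
  by rewrite -scalemxAr basis_mul_ray scalerN scaleNr.
have zw : lexle c z (z + w).
  apply: zmin => k; rewrite slackD Aw scaleNr opprK mxE addr_ge0 // !mxE.
  by rewrite mulr_ge0 // zfeas.
have wz : lexle c z (z - w).
  apply: zmin => k; rewrite slackD mulmxN Aw scaleNr !opprK mxE [X in _ + X]mxE.
  rewrite [X in - X]mxE [delta_mx _ _ _ _]mxE andbT.
  by case: eqP => [->|_]; rewrite ?mulr1 ?subrr // mulr0 subr0.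
have := lexle_addr w wz; rewrite subrK => /(lexle_anti zw) /esym/eqP.
rewrite -subr_eq0 addrC addKr => /eqP w0.
have := congr1 (fun v : 'cV_d => v m 0) Aw.
by rewrite w0 mulmx0 !mxE !eqxx mulr1 => /eqP; rewrite eq_sym oppr_eq0 => /eqP.
Qed.

Lemma basis_solution : z = invmx (basis_mx B) *m basis_rhs B.
Proof.
by have /eqP := basis_slack0; rewrite subr_eq0 => /eqP ->; rewrite mulKmx.
Qed.

(** The slack of [z + ray m] is the [m]-th unit vector, so this point is feasible and does not
    precede [z]. *)
Lemma ray_lexge0 m : lexle c 0 (ray m).
Proof.
have : lexle c z (z + ray m).
  apply: zmin => k; rewrite slackD basis_slack0 basis_mul_ray opprK add0r mxE.
  exact: ler0n.
by move/(lexle_addr (- z)); rewrite subrr addrAC subrr add0r.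
Qed.

(** With $z = A_B^{-1} b_B$, the sum is $-A_B^{-1}(b_B - A_B y) = y - z$. *)
Lemma ray_decomposition y : y = z + \sum_m slack y m 0 *: ray m.
Proof.
have -> : \sum_m slack y m 0 *: ray m = - invmx (basis_mx B) *m slack y.
  apply/colP => i; rewrite summxE mxE; apply: eq_bigr => m _.
  by rewrite [LHS]mxE mulrC [col _ _ _ _]mxE.
by rewrite mulNmx mulmxBr -basis_solution mulKmx // opprB addrC subrK.
Qed.

Lemma lexkey_ray_decomposition k y :
  lexkey c k y = lexkey c k z + \sum_m slack y m 0 * lexkey c k (ray m).
Proof.
rewrite {1}(ray_decomposition y) lexkeyD /lexkey dotv_sumr.
by congr (_ + _); apply: eq_bigr => m _; rewrite dotvZr.
Qed.

(* The rays are lexicographically positive, so a point of the basis cone that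
   ties with its apex z on the first k keys only uses rays whose first k keys
   vanish. *)
Lemma ray_lexkey0 k y : polyhedron B y ->
  (forall j, (j < k)%N -> lexkey c j y = lexkey c j z) ->
  forall m j, (j < k)%N -> slack y m 0 != 0 -> lexkey c j (ray m) = 0.
Proof.
move=> /basis_polyhedronP sy; elim: k => // k IHk eqyz m j.
have {}IHk := IHk (fun j jk => eqyz j (leqW jk)).
rewrite ltnS leq_eqVlt => /orP[/eqP-> {j}|]; last exact: IHk.
have pos i : 0 <= slack y i 0 * lexkey c k (ray i).
  have [->|yi] := eqVneq (slack y i 0) 0; first by rewrite mul0r.
  rewrite mulr_ge0 // -(dotv0r (lexrow c k)); apply: lexle_key (ray_lexge0 i) _.
  by move=> j jk; rewrite IHk // /lexkey dotv0r.
(* The tie on key [k] makes a sum of nonnegative terms vanish, hence each of its terms. *)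
have /eqP := lexkey_ray_decomposition k y.
rewrite eqyz // addrC -subr_eq subrr eq_sym psumr_eq0 //.
by move=> /allP/(_ m (mem_index_enum _)); rewrite mulf_eq0 => /orP[->|/eqP].
Qed.

Lemma lexkey_ray_ge0 k y : polyhedron B y ->
  (forall j, (j < k)%N -> lexkey c j y = lexkey c j z) ->
  forall m, slack y m 0 != 0 -> 0 <= lexkey c k (ray m).
Proof.
move=> Py eqyz m ym; rewrite -(dotv0r (lexrow c k)).
apply: lexle_key (ray_lexge0 m) _ => j jk.
by rewrite (ray_lexkey0 Py eqyz) // /lexkey dotv0r.
Qed.

End Basis.

Section MIGCut.
Variables (R : realType) (dZ dR : nat).
Local Notation d := (dZ + dR)%N.
Variables (c z : 'cV[R]_d) (B : d.-tuple (halfspace R d)) (l : 'I_d).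
Local Notation f := ((Num.floor (z l 0))%:~R : R).

Lemma mig_LambdaE m : mig_Lambda z B l m 0 =
  if ray B m l 0 < 0 then ray B m l 0 / (f - z l 0)
  else if 0 < ray B m l 0 then ray B m l 0 / (f + 1 - z l 0) else 0.
Proof.
rewrite mxE /mig_lambda -/(ray B m).
by case: ifP => _; [|case: ifP => _ //]; rewrite mul1r invf_div.
Qed.

(** In slack coordinates the cut reads $\Lambda^\top s \ge 1$; it removes the apex, where all slacks
    are 0. *)
Lemma mig_cutP y : dotv (mig_cut z B l).1 y <= (mig_cut z B l).2 <->
  1 <= \sum_m mig_Lambda z B l m 0 * slack B y m 0.
Proof.
rewrite -dotvE /slack dotvBr.
have -> : dotv (mig_cut z B l).1 y = dotv (mig_Lambda z B l) (basis_mx B *m y).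
  by rewrite /dotv /= trmxK mulmxA.
by rewrite /= lerBrDr addrC -lerBrDr.
Qed.

Hypotheses (zopt : is_lexopt (polyhedron B) c z) (Bu : basis_mx B \in unitmx).
Hypothesis zl : z l 0 \isn't a Num.int.

Let f_lt : f < z l 0.
Proof. by rewrite lt_neqAle -intrEfloor zl /= floor_le. Qed.

Let lt_f1 : z l 0 < f + 1.
Proof. by have := floorD1_gt (z l 0); rewrite intrD. Qed.

Let decompE (y : 'cV[R]_d) : y l 0 = z l 0 + \sum_m slack B y m 0 * ray B m l 0.
Proof.
have := lexkey_ray_decomposition zopt Bu l.+1 y; rewrite !lexkeyS => ->.
by congr (_ + _); apply: eq_bigr => m _; rewrite lexkeyS.
Qed.

(** Each $\Lambda_m$ is the larger of the quotients $r^m_\ell / g$ for $g = f - z_\ell$ and $g = f +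
    1 - z_\ell$. Taking the $g$ of the side on which [y] lies, the weighted sum is at least $(y_\ell
    - z_\ell)/g \ge 1$. *)
Lemma mig_cut_valid (y : 'cV[R]_d) : polyhedron B y -> y l 0 \is a Num.int ->
  dotv (mig_cut z B l).1 y <= (mig_cut z B l).2.
Proof.
move=> /basis_polyhedronP sy /intrP[n yn]; apply/mig_cutP.
have sum_ge g : (forall m, ray B m l 0 / g <= mig_Lambda z B l m 0) ->
    1 <= (y l 0 - z l 0) / g ->
    1 <= \sum_m mig_Lambda z B l m 0 * slack B y m 0.
  move=> Lg /le_trans; apply; rewrite decompE addrC addKr mulr_suml.
  by apply: ler_sum => m _; rewrite -mulrA [leRHS]mulrC ler_wpM2l.
have [yf|fy] := lerP (y l 0) f.
- apply: (sum_ge (f - z l 0)) => [m|]; last first.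
    by rewrite ler_ndivlMr ?subr_lt0 // mul1r lerD2r.
  rewrite mig_LambdaE; case: ltgtP => [//|r0|->]; last by rewrite mul0r.
  apply: (@le_trans _ _ 0).
    by rewrite pmulr_rle0 // invr_le0 subr_le0 ltW.
  by rewrite divr_ge0 ?subr_ge0 // ltW.
- have f1y : f + 1 <= y l 0.
    by move: fy; rewrite yn -(intrD _ _ 1) ltr_int ler_int -ltzD1 ltrD2r.
  apply: (sum_ge (f + 1 - z l 0)) => [m|]; last first.
    by rewrite ler_pdivlMr ?subr_gt0 // mul1r lerD2r.
  rewrite mig_LambdaE; case: ltgtP => [r0|//|->]; last by rewrite mul0r.
  apply: (@le_trans _ _ 0).
    by rewrite nmulr_rle0 // invr_ge0 subr_ge0 ltW.
  by rewrite nmulr_rge0 // invr_le0 subr_le0 ltW.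
Qed.

(* The rays used by such a y have a nonnegative l-th entry r_l, so the cut
   weights are all r_l / (floor z_l + 1 - z_l). *)
Lemma mig_cut_progress (y : 'cV[R]_d) : polyhedron B y ->
  dotv (mig_cut z B l).1 y <= (mig_cut z B l).2 ->
  (forall j, (j < l.+1)%N -> lexkey c j y = lexkey c j z) ->
  f + 1 <= y l 0.
Proof.
move=> Py /mig_cutP cut eqyz.
suff Lg m : mig_Lambda z B l m 0 * slack B y m 0 =
    slack B y m 0 * ray B m l 0 / (f + 1 - z l 0).
  move: cut; rewrite (eq_bigr _ (fun m _ => Lg m)) -mulr_suml.
  rewrite ler_pdivlMr ?subr_gt0 // mul1r => g_le.
  by rewrite (decompE y) -lerBlDl.
rewrite mulrC -mulrA; have [->|ym] := eqVneq (slack B y m 0) 0.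
  by rewrite !mul0r.
(* The cost is key 0, so entry [l] is key [l.+1], the first one on which no tie is assumed. *)
have := lexkey_ray_ge0 zopt Bu Py eqyz ym; rewrite lexkeyS mig_LambdaE.
by case: ltgtP => // ->; rewrite !mul0r.
Qed.

End MIGCut.

(** * Stationary sequences *)

(** Induction on the gap between [U] and [f T0]: if [f] is not constant from [T0] on, a later value
    shrinks the gap. *)
Lemma bounded_nondecreasing_int_stationary (f : nat -> int) (U : int)
    (T0 : nat) :
  (forall t, (T0 <= t)%N -> f t <= f t.+1) ->
  (forall t, (T0 <= t)%N -> f t <= U) ->
  exists2 T, (T0 <= T)%N & forall t, (T <= t)%N -> f t = f T.
Proof.
move=> fS fU.
have mono s t : (T0 <= s)%N -> (s <= t)%N -> f s <= f t.
  move=> Ts /subnKC <-; elim: (t - s)%N => [|k IHk]; first by rewrite addn0.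
  by rewrite addnS (le_trans IHk) // fS // (leq_trans Ts) ?leq_addr.
have [k] := ubnP `|U - f T0|%N.
elim: k T0 fS fU mono => // k IHk T0 fS fU mono Uk.
have [const|/existsNP[t /not_implyP[Tt /eqP ft]]] :=
  pselect (forall t, (T0 <= t)%N -> f t = f T0); first by exists T0.
have f_lt : f T0 < f t by rewrite lt_neqAle eq_sym ft mono.
have ftU := fU t Tt.
have [||s u ts su||T tT fT] := IHk t.
- by move=> s ts; apply: fS; apply: leq_trans ts.
- by move=> s ts; apply: fU; apply: leq_trans ts.
- by apply: mono => //; apply: leq_trans ts.
- by lia.
by exists T => //; apply: leq_trans tT.
Qed.

(** Induction on the list of candidates: by antisymmetry a value once left never recurs, so it can
    be struck from the list. *)
Lemma lexle_finite_stationary (R : realType) (d : nat) (c : 'cV[R]_d)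
    (u : nat -> 'cV[R]_d) (s : seq 'cV[R]_d) (T0 : nat) :
  (forall t t', (t <= t')%N -> lexle c (u t) (u t')) ->
  (forall t, (T0 <= t)%N -> u t \in s) ->
  exists2 T, (T0 <= T)%N & forall t, (T <= t)%N -> u t = u T.
Proof.
move=> umono; have [k] := ubnP (size s); elim: k s T0 => // k IHk s T0 sk us.
have [const|/existsNP[t /not_implyP[Tt ut]]] :=
  pselect (forall t, (T0 <= t)%N -> u t = u T0); first by exists T0.
have [||T tT uT] := IHk [seq x <- s | x != u T0] t.
- rewrite ltnS in sk; apply: leq_trans sk.
  rewrite size_filter -(count_predC (pred1 (u T0))).
  rewrite -[X in (X < _)%N]add0n ltn_add2r.
  by rewrite -has_count has_pred1 us.
- move=> t' tt'; rewrite mem_filter us ?(leq_trans Tt) // andbT.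
  apply/eqP => ut'; apply: ut; apply: (@lexle_anti _ _ c); last exact: umono.
  by rewrite -ut'; exact: umono.
by exists T => //; apply: leq_trans tT.
Qed.

Lemma connect_lexle (R : realType) (d : nat) (c : 'cV[R]_d) (n : nat)
    (e : rel 'I_n) (u : 'I_n -> 'cV[R]_d) :
  (forall i j, e i j -> lexle c (u i) (u j)) ->
  forall i j, connect e i j -> lexle c (u i) (u j).
Proof.
move=> eu i j /connectP[p]; elim: p i => [i _ ->|k p IHp i /=].
  exact: lexle_refl.
move=> /andP[/eu ik] kp jE.
exact: lexle_trans ik (IHp _ kp jE).
Qed.

Lemma finite_eventually (n : nat) (P : 'I_n -> nat -> Prop) :
  (forall i, exists T, forall t, (T <= t)%N -> P i t) ->
  exists T, forall i t, (T <= t)%N -> P i t.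
Proof.
move=> /choice[T TP]; exists (\max_i T i)%N => i t Tt; apply: TP.
exact: leq_trans (leq_bigmax i) Tt.
Qed.

(** * The first fractional entry of a point *)

Section FirstFractional.
Variables (R : realType) (dZ dR : nat).
Implicit Type z : 'cV[R]_(dZ + dR).

Lemma first_fractional_Some z (k : 'I_dZ) :
  z (lshift dR k) 0 \isn't a Num.int ->
  (forall j : 'I_dZ, (j < k)%N -> z (lshift dR j) 0 \is a Num.int) ->
  first_fractional z = Some k.
Proof.
move=> zk zlt; rewrite /first_fractional.
case: pickP => [k' /andP[zk' /forallP zlt']|/(_ k)].
  congr (Some _); apply: ord_inj; case: (ltngtP k' k) => // kk'.
    by rewrite zlt in zk'.
  by case/negP: zk; apply: implyP (zlt' k) kk'.
rewrite zk /= => /negP[]; apply/forallP => j; apply/implyP; exact: zlt.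
Qed.

Lemma first_fractional_int z :
  (forall k, z (lshift dR k) 0 \is a Num.int) -> first_fractional z = None.
Proof.
by move=> zint; rewrite /first_fractional; case: pickP => // k; rewrite zint.
Qed.

Lemma first_fractionalP z k :
  first_fractional z = Some k -> z (lshift dR k) 0 \isn't a Num.int.
Proof. by rewrite /first_fractional; case: pickP => // j /andP[? _] [<-]. Qed.

End FirstFractional.

(** * The feasible set and the optimal cost of the MILP *)

Section Feasible.
Variables (R : realType) (dZ dR n : nat).
Local Notation d := (dZ + dR)%N.
Variables (c : 'cV[R]_d) (a : 'I_n -> 'cV[R]_d) (b : 'I_n -> R) (M : R).

Lemma milp_PI_closed : closed (milp_PI a b).
Proof.
have -> : milp_PI a b = polyhedron [seq (a i, b i) | i <- enum 'I_n] `&`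
    \bigcap_(k in [set: 'I_dZ])
      ((fun y : 'cV[R]_d => y (lshift dR k) 0) @^-1` [set x | x \is a Num.int]).
  apply/seteqP; split=> y [Py yint]; split.
  - by move=> h /mapP[i _ ->]; exact: Py.
  - by move=> k _; exact: yint.
  - by move=> i; apply: (Py (a i, b i)); apply: map_f; rewrite mem_enum.
  - by move=> k; exact: (yint k).
apply: closedI; first exact: polyhedron_closed.
apply: closed_bigI => k _; apply: preimage_closed; last exact: closed_Rint.
by move=> y _; exact: coord_continuous.
Qed.

(** The empty set is convex, so it would contain the hull of an empty [A]. *)
Lemma conv_hull_nonempty (A : set 'cV[R]_d) : conv_hull A !=set0 -> A !=set0.
Proof.
move=> [x Ax]; apply/set0P/eqP => A0; apply: (Ax set0).
split; last by rewrite A0.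
by move=> y y' lambda; rewrite inE.
Qed.

Lemma milp_cost_lexopt z :
  is_lexopt (milp_PI a b) c z -> milp_cost c a b = dotv c z.
Proof.
move=> [[Pz zmin] _]; apply/le_anti/andP; split.
  by apply: ge_inf; [exists (dotv c z) => _ [y /zmin ? <-]|exists z].
by apply: lb_le_inf; [exists (dotv c z), z|move=> _ [y /zmin ? <-]].
Qed.

End Feasible.

(** * Runs of the algorithm *)

Section Run.
Variables (R : realType) (dZ dR n : nat).
Local Notation d := (dZ + dR)%N.
Variables (c : 'cV[R]_d) (a : 'I_n -> 'cV[R]_d) (b : 'I_n -> R) (M : R).
Variables (E : nat -> rel 'I_n) (z : nat -> 'I_n -> 'cV[R]_d).
Variable B : nat -> 'I_n -> d.-tuple (halfspace R d).

Local Notation PI := (milp_PI a b).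
Local Notation loc := (local_constraints a b M).
Local Notation tmp t i := (tmp_constraints c a b M E (z t) (B t) t i).

Hypothesis PI_box : PI `<=` polyhedron (box d M).
Variable zopt : 'cV[R]_d.
Hypothesis zoptP : is_lexopt PI c zopt.
Hypothesis cost_int : dotv c zopt \is a Num.int.
Hypothesis run : int_dicut_run c a b M E z B.

Let PI_min y : PI y -> lexle c zopt y.
Proof. by move=> Py; have [_] := (is_lexoptP _ _ _).1 zoptP; apply. Qed.

Let PI_zopt : PI zopt.
Proof. by have [] := (is_lexoptP _ _ _).1 zoptP. Qed.

(** * Validity of the generated half-spaces *)

Lemma PI_local i : PI `<=` polyhedron (loc i).
Proof.
move=> y Py h; rewrite inE => /orP[/eqP->|hb]; first by case: Py => + _; apply.
exact: PI_box.
Qed.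

(** The invariant of a run. Keeping [PI] inside every basis keeps the next LP feasible, so that the
    conditional specification [LPlexsolv] yields an answer. *)
Definition sound t i := [/\ is_lexopt (polyhedron (B t i)) c (z t i),
  basis_mx (B t i) \in unitmx, PI `<=` polyhedron (B t i)
  & polyhedron (loc i) (z t i)].

(** The box among the local constraints makes the LP compact and [zopt] makes it feasible, so its
    lex-optimal solution exists. *)
Lemma LPlexsolv_sound t i (H : seq (halfspace R d)) :
  PI `<=` polyhedron H -> {subset loc i <= H} ->
  LPlexsolv H c (z t i) (B t i) ->
  [/\ polyhedron H (z t i), {subset B t i <= H} & sound t i].
Proof.
move=> PIH locH solv; have [|zH [BH zB _ Bu]] := solv.
  apply: compact_lexopt; last by exists zopt; apply: PIH.
  apply: (@closed_box_compact _ _ M); first exact: polyhedron_closed.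
  by move=> y Hy h hb; apply: Hy; apply: locH; rewrite inE hb orbT.
have Hz : polyhedron H (z t i) by have [] := (is_lexoptP _ _ _).1 zH.
split=> //; split=> // [y /PIH Hy h /BH|h /locH]; first exact: Hy.
exact: Hz.
Qed.

Lemma mem_tmp_neighbor t i j : E t j i -> {subset B t j <= tmp t i}.
Proof.
move=> Eji h hB; rewrite mem_cat; apply/orP; left; apply/flattenP.
by exists (tval (B t j)) => //; apply: map_f; rewrite mem_filter Eji mem_enum.
Qed.

Lemma mem_tmp_self t i : {subset B t i <= tmp t i}.
Proof. by move=> h hB; rewrite !mem_cat hB ?orbT. Qed.

Lemma mem_tmp_local t i : {subset loc i <= tmp t i}.
Proof. by move=> h hB; rewrite !mem_cat hB ?orbT. Qed.

Lemma mem_tmp_mig t i : {subset MIGoracle (z t i) (B t i) <= tmp t i}.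
Proof. by move=> h hB; rewrite !mem_cat hB ?orbT. Qed.

Lemma mem_tmp_cost t i : cost_cut c (z t i) \in tmp t i.
Proof. by rewrite !mem_cat mem_seq1 eqxx ?orbT. Qed.

Lemma tmpP t i h : h \in tmp t i -> [\/ exists j, h \in tval (B t j),
  h \in loc i, h \in MIGoracle (z t i) (B t i) | h = cost_cut c (z t i)].
Proof.
rewrite mem_cat => /orP[/flattenP[s /mapP[j _ ->] hj]|].
  by apply: Or41; exists j.
rewrite mem_cat => /orP[hi|]; first by apply: Or41; exists i.
rewrite mem_cat => /orP[hi|]; first exact: Or42.
by rewrite mem_cat mem_seq1 => /orP[hi|/eqP hi]; [exact: Or43 | exact: Or44].
Qed.

Lemma sound_lexle_opt t i : sound t i -> lexle c (z t i) zopt.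
Proof.
move=> [zB _ PIB _]; have [_] := (is_lexoptP _ _ _).1 zB; apply; exact: PIB.
Qed.

(** The MIG cut keeps the points whose cut entry is an integer; the cost cut is valid because the
    optimal cost is an integer bounding the current cost from above, hence bounding its ceiling. *)
Lemma PI_tmp t i : (forall j, sound t j) -> PI `<=` polyhedron (tmp t i).
Proof.
move=> snd y Py h /tmpP[[j]| | |->].
- by case: (snd j) => _ _ PIB _; apply: PIB.
- exact: PI_local.
- have [zB Bu PIB _] := snd i; rewrite /MIGoracle.
  case ff: first_fractional => [k|] //; rewrite mem_seq1 => /eqP->.
  apply: (mig_cut_valid zB Bu); first exact: first_fractionalP ff.
    exact: PIB.
  by case: Py => _; apply.
- rewrite /cost_cut /= dotvNl lerN2.
  have zy : dotv c zopt <= dotv c y.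
    by apply: (@lexle_key _ _ c _ _ 0) => //; exact: PI_min.
  apply: le_trans zy; move: cost_int => /intrP[m mE].
  rewrite mE ler_int ceil_le_int -mE.
  by apply: (@lexle_key _ _ c _ _ 0) => //; apply: sound_lexle_opt.
Qed.

Lemma run_sound t i : sound t i.
Proof.
elim: t i => [|t IHt] i.
  by have [] := LPlexsolv_sound (@PI_local i) (fun h hb => hb) (run.1 i).
have PIt := @PI_tmp t i IHt.
by have [] := LPlexsolv_sound PIt (@mem_tmp_local t i) (run.2 t i).
Qed.

(** * Monotonicity and progress of the estimates *)

Lemma run_step t i :
  polyhedron (tmp t i) (z t.+1 i) /\ {subset B t.+1 i <= tmp t i}.
Proof.
have PIt := @PI_tmp t i (run_sound t).
by have [] := LPlexsolv_sound PIt (@mem_tmp_local t i) (run.2 t i).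
Qed.

(** The new estimate lies in the basis of agent [j], whose lexicographic minimum is [z t j]. The
    case [j = i] gives monotonicity, an in-neighbour [j] gives consensus. *)
Lemma run_lexle_of_subset t i j :
  {subset B t j <= tmp t i} -> lexle c (z t j) (z t.+1 i).
Proof.
move=> sub; have [zB _ _ _] := run_sound t j.
have [_] := (is_lexoptP _ _ _).1 zB; apply=> h /sub; exact: (run_step t i).1.
Qed.

Lemma run_mono t t' i : (t <= t')%N -> lexle c (z t i) (z t' i).
Proof.
move=> /subnKC <-; elim: (t' - t)%N => [|k IHk].
  by rewrite addn0; exact: lexle_refl.
rewrite addnS; apply: lexle_trans IHk _.
exact/run_lexle_of_subset/mem_tmp_self.
Qed.

(** Key 0 is pushed by the cost cut. For a later key, integrality of the preceding ones makes its
    entry, if fractional, the one that the oracle cuts. *)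
Lemma run_key_progress t i k : (k <= dZ)%N ->
  (forall m, (m < k)%N -> lexkey c m (z t.+1 i) = lexkey c m (z t i) /\
     lexkey c m (z t i) \is a Num.int) ->
  (Num.ceil (lexkey c k (z t i)))%:~R <= lexkey c k (z t.+1 i).
Proof.
case: k => [_ _|k kd tie].
  by have := (run_step t i).1 _ (mem_tmp_cost t i); rewrite /= dotvNl lerN2.
have eqk m : (m < k.+1)%N -> lexkey c m (z t.+1 i) = lexkey c m (z t i).
  by move=> /tie[].
have keyE (j : 'I_dZ) y : lexkey c j.+1 y = y (lshift dR j) 0.
  by rewrite -[val j]/(val (lshift dR j)) lexkeyS.
pose l := Ordinal kd; rewrite -[k]/(val l) !keyE.
have [zl|zl] := boolP (z t i (lshift dR l) 0 \is a Num.int).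
  move: (zl); rewrite intrEceil => /eqP ->; rewrite -!keyE.
  apply: lexle_key; first exact: run_mono.
  by move=> m mk; rewrite eqk.
have ff : first_fractional (z t i) = Some l.
  by apply: first_fractional_Some => // j jl; rewrite -keyE; apply: (tie _ _).2.
have [zB Bu _ _] := run_sound t i.
have cut : mig_cut (z t i) (B t i) (lshift dR l) \in tmp t i.
  by apply: mem_tmp_mig; rewrite /MIGoracle ff mem_seq1.
have := mig_cut_progress zB Bu _ ((run_step t i).1 _ cut) eqk.
rewrite ceil_floor zl intrD; apply=> h /mem_tmp_self; exact: (run_step t i).1.
Qed.

(* Once the earlier keys are constant, each round brings the next key at least
   to its ceiling; the ceilings are nondecreasing and bounded. *)
Lemma run_keys_stationary i k : (k <= dZ.+1)%N ->
  exists T, forall t, (T <= t)%N -> forall m, (m < k)%N ->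
    lexkey c m (z t i) = lexkey c m (z T i) /\ lexkey c m (z T i) \is a Num.int.
Proof.
elim: k => [|k IHk] kd; first by exists 0.
have [T0 T0P] := IHk (ltnW kd).
have tie t m : (T0 <= t)%N -> (m < k)%N ->
    lexkey c m (z t.+1 i) = lexkey c m (z t i) /\
    lexkey c m (z t i) \is a Num.int.
  move=> Tt mk; have [-> zint] := T0P t Tt m mk.
  by have [-> _] := T0P t.+1 (leqW Tt) m mk.
have [U UP] : exists U, forall t, (T0 <= t)%N -> lexkey c k (z t i) <= U.
  case: k kd {IHk T0P tie} => [_|k kd].
    exists (dotv c zopt) => t _; apply: (@lexle_key _ _ c _ _ 0) => //.
    exact: sound_lexle_opt (run_sound t i).
  exists M => t _; have [_ _ _ zloc] := run_sound t i.
  have kd' : (k < d)%N by rewrite ltnS in kd; exact: ltn_addr.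
  rewrite -[k]/(val (Ordinal kd')) lexkeyS.
  have zbox : polyhedron (box d M) (z t i).
    by move=> h hb; apply: zloc; rewrite inE hb orbT.
  by have /andP[] := box_bounds zbox (Ordinal kd').
have prog t : (T0 <= t)%N ->
    (Num.ceil (lexkey c k (z t i)))%:~R <= lexkey c k (z t.+1 i).
  by move=> Tt; apply: run_key_progress => // m; exact: tie.
have [||T T0T TP] := @bounded_nondecreasing_int_stationary
    (fun t => Num.ceil (lexkey c k (z t i))) (Num.ceil U) T0.
- by move=> t Tt; rewrite -(ler_int R) (le_trans (prog t Tt)) // ceil_ge.
- by move=> t Tt; apply: le_ceil; exact: UP.
(* One round after the ceilings settle, the key lies between the previous ceiling and its own, which
   coincide. *)
have zk t : (T.+1 <= t)%N ->
    lexkey c k (z t i) = (Num.ceil (lexkey c k (z T i)))%:~R.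
  case: t => // t Tt; apply/le_anti; rewrite -{1}(TP t.+1) 1?ceil_ge ?leqW //=.
  by rewrite -(TP t) // prog // (leq_trans T0T).
exists T.+1 => t Tt m; rewrite ltnS leq_eqVlt => /orP[/eqP->|mk].
  by rewrite (zk t) // (zk T.+1) //; split=> //; exact: intr_int.
have [-> zint] := T0P t (leq_trans T0T (ltnW Tt)) m mk.
by have [-> _] := T0P T.+1 (leqW T0T) m mk.
Qed.

(** * Stationarity and consensus in finite time *)

Lemma run_integral : exists T, forall i t, (T <= t)%N ->
  dotv c (z t i) = dotv c (z T i) /\
  forall k, z t i (lshift dR k) 0 \is a Num.int.
Proof.
have [T TP] : exists T, forall i t, (T <= t)%N -> forall t', (t <= t')%N ->
    forall m, (m < dZ.+1)%N ->
    lexkey c m (z t' i) = lexkey c m (z t i) /\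
    lexkey c m (z t' i) \is a Num.int.
  apply: finite_eventually => i.
  have [T TP] := @run_keys_stationary i _ (leqnn _).
  exists T => t Tt t' tt' m md; have [-> ?] := TP t' (leq_trans Tt tt') m md.
  by have [-> _] := TP t Tt m md.
exists T => i t Tt; split; first by have [] := TP i T (leqnn T) t Tt 0.
move=> k; have [_] := TP i T (leqnn T) t Tt k.+1 (ltn_ord k).
by rewrite -[val k]/(val (lshift dR k)) lexkeyS.
Qed.

(* Once all the integer entries are integral no new cut is generated, and the
   bases are drawn from a finite pool of half-spaces. *)
Lemma run_stationary : exists T, forall i t, (T <= t)%N ->
  z t i = z T i /\ forall k, z t i (lshift dR k) 0 \is a Num.int.
Proof.
have [T0 T0P] := run_integral.
(* The cost cuts at [T0] suffice, since the costs are constant from then on. *)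
pose pool := flatten [seq tval (B T0 j) | j <- enum 'I_n] ++
  flatten [seq cost_cut c (z T0 j) :: loc j | j <- enum 'I_n].
have in_pool j h : h \in cost_cut c (z T0 j) :: loc j -> h \in pool.
  move=> hj; rewrite mem_cat; apply/orP; right; apply/flattenP.
  exists (cost_cut c (z T0 j) :: loc j) => //.
  by apply/mapP; exists j; rewrite ?mem_enum.
have B_pool t : (T0 <= t)%N -> forall i, {subset B t i <= pool}.
  move=> /subnKC <-; elim: (t - T0)%N => [|k IHk] i h.
    rewrite addn0 => hB; rewrite mem_cat; apply/orP; left; apply/flattenP.
    by exists (tval (B T0 i)) => //; apply: map_f; rewrite mem_enum.
  rewrite addnS => /(run_step _ _).2/tmpP[[j]|hi||->].
  - exact: IHk.
  - by apply: (in_pool i); rewrite inE hi orbT.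
  - have [_ zint] := T0P i _ (leq_addr k T0).
    by rewrite /MIGoracle first_fractional_int.
  - have [zc _] := T0P i _ (leq_addr k T0).
    by apply: (in_pool i); rewrite /cost_cut zc inE eqxx.
(* An estimate is determined by its basis, so it is enough to list the solutions of all [d]-tuples
   of the pool. [h0] is only the default of [nth]; all indices are in range. *)
pose sol (B' : d.-tuple (halfspace R d)) := invmx (basis_mx B') *m basis_rhs B'.
pose h0 : halfspace R d := (0, 0).
pose vals := [seq sol [tuple nth h0 pool (tnth f m) | m < d]
  | f : d.-tuple 'I_(size pool)].
have z_vals t i : (T0 <= t)%N -> z t i \in vals.
  move=> Tt; have [zB Bu _ _] := run_sound t i.
  have idx m : (index (tnth (B t i) m) pool < size pool)%N.
    by rewrite index_mem; apply: B_pool (mem_tnth _ _).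
  apply/mapP; exists [tuple Ordinal (idx m) | m < d]; first by rewrite mem_enum.
  rewrite (basis_solution zB Bu) -/(sol _); congr sol; apply: eq_from_tnth => m.
  by rewrite !tnth_mktuple nth_index // -index_mem.
have [T TP] : exists T, forall i t, (T <= t)%N ->
    forall t', (t <= t')%N -> z t' i = z t i.
  apply: finite_eventually => i.
  have [T _ TP] := lexle_finite_stationary (fun t t' => @run_mono t t' i)
    (fun t => z_vals t i).
  by exists T => t Tt t' tt'; rewrite !TP // (leq_trans Tt).
exists (maxn T0 T) => i t; rewrite geq_max => /andP[T0t Tt]; split.
  by rewrite (TP i T) // (TP i T (leqnn T) (maxn T0 T)) ?leq_maxr.
by have [] := T0P i t T0t.
Qed.

Lemma run_converges : jointly_strongly_connected E ->
  exists T, forall t i, (T <= t)%N -> z t i = zopt.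
Proof.
move=> joint; have [T TP] := run_stationary; exists T => t i Tt.
have [-> _] := TP i t Tt; move: i.
(* An edge at time [tau] compares [z tau i] with [z tau.+1 j], and both already equal their values
   at [T]. *)
have le_conn i j : lexle c (z T i) (z T j).
  apply: connect_lexle (joint T i j) => {}i {}j /asboolP[tau Ttau Eij].
  have [<- _] := TP i tau Ttau; have [<- _] := TP j tau.+1 (leqW Ttau).
  exact/run_lexle_of_subset/mem_tmp_neighbor.
move=> i; apply: (@lexle_anti _ _ c).
  exact: sound_lexle_opt (run_sound T i).
apply: PI_min; split=> [j|]; last by have [] := TP i T (leqnn T).
rewrite (lexle_anti (le_conn i j) (le_conn j i)).
have [_ _ _ zloc] := run_sound T j.
by apply: (zloc (a j, b j)); rewrite inE eqxx.
Qed.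

End Run.

Theorem mainTheorem1 (R : realType) (dZ dR n : nat)
    (c : 'cV[R]_(dZ + dR)) (a : 'I_n -> 'cV[R]_(dZ + dR)) (b : 'I_n -> R)
    (M : R) (E : nat -> rel 'I_n)
    (z : nat -> 'I_n -> 'cV[R]_(dZ + dR))
    (B : nat -> 'I_n -> (dZ + dR).-tuple (halfspace R (dZ + dR))) :
  bounded_set (milp_P a b) ->
  conv_hull (milp_PI a b) !=set0 ->
  0 < M ->
  milp_P a b `<=` polyhedron (box (dZ + dR) M) ->
  milp_cost c a b \is a Num.int ->
  jointly_strongly_connected E ->
  int_dicut_run c a b M E z B ->
  exists zopt : 'cV[R]_(dZ + dR),
    is_lexopt (milp_PI a b) c zopt /\
    exists T : nat, forall (t : nat) (i : 'I_n), (T <= t)%N ->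
      dotv c (z t i) = milp_cost c a b /\ z t i = zopt.
Proof.
move=> _ /conv_hull_nonempty PI0 _ P_box cost_int joint run.
have PI_box : milp_PI a b `<=` polyhedron (box (dZ + dR) M).
  by move=> y [/P_box].
have [zopt zoptP] : exists zopt, is_lexopt (milp_PI a b) c zopt.
  apply: compact_lexopt PI0; apply: closed_box_compact PI_box.
  exact: milp_PI_closed.
rewrite (milp_cost_lexopt zoptP) in cost_int *.
exists zopt; split=> //.
have [T TP] := run_converges PI_box zoptP cost_int run joint.
by exists T => t i Tt; rewrite TP.
Qed.
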